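(* Let $u^2$ and $t$ be rational numbers with $0<u^2<t-1$, and let $\Delta(u^2,2t)\subset\operatorname{PSL}_2(\mathbb{R})$ be the group generated by \[ g_1 = \frac{1}{\sqrt{-1+t-u^2}}\begin{pmatrix} t-1 & u^2 \\ 1 & 1 \end{pmatrix},\qquad g_2 = \frac{1}{u\sqrt{-1+t-u^2}}\begin{pmatrix} u^2 & u^2 \\ 1 & t-u^2 \end{pmatrix}, \] where $u=\sqrt{u^2}>0$. Then $\Delta(u^2,2t)$ is pseudomodular or arithmetic if and only if its set of finite cusps $\mathcal{C}(\Delta(u^2,2t))\subset\mathbb{Q}$ is dense in the ring $\mathbb{A}_{\mathbb{Q},f}$ of finite adeles of $\mathbb{Q}$ (with $\mathbb{Q}$ embedded diagonally).
   Context: A cusp of a Fuchsian group $G\subset\operatorname{PSL}_2(\mathbb{R})$ is a point $x\in\mathbb{P}^1(\mathbb{R})$ that is the unique fixed point of some (parabolic) element of $G$. $\mathcal{C}_\infty(G)$ denotes the set of cusps and $\mathcal{C}(G)=\mathcal{C}_\infty(G)\setminus\{\infty\}$ the finite cusps. For the groups $\Delta(u^2,2t)$ above, $\Delta$ is a Fuchsian group of finite coarea (freely generated by $g_1,g_2$) whose cusps lie in $\mathbb{P}^1(\mathbb{Q})$. A finite coarea Fuchsian group is arithmetic if it is commensurable with $\operatorname{PSL}_2(\mathbb{Z})$, and pseudomodular if it is not arithmetic (nonarithmetic) and its cusp set is exactly $\mathbb{P}^1(\mathbb{Q})$. The finite adeles are $\mathbb{A}_{\mathbb{Q},f}=\mathbb{Q}\otimes_{\mathbb{Z}}\widehat{\mathbb{Z}}$,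 where $\widehat{\mathbb{Z}}$ is the profinite completion of $\mathbb{Z}$; it is an additive topological group with a basis of open neighborhoods of $0$ given by $m\widehat{\mathbb{Z}}$, $m\in\mathbb{Q}^\times$. *)

(* Defs.v *)
From HB Require Import structures.
From mathcomp Require Import all_boot all_order all_algebra.
From mathcomp Require Import ring lra.
From mathcomp Require Import all_classical reals topology_structure.

Set Implicit Arguments.
Unset Strict Implicit.
Unset Printing Implicit Defensive.
Import Order.TTheory GRing.Theory Num.Theory.

Local Open Scope classical_set_scope.
Local Open Scope ring_scope.
Local Open Scope quotient_scope.

Definition mx22 (F : Type) (a b c d : F) : 'M[F]_2 :=
  \matrix_(i, j) nth d (nth [::] [:: [:: a; b]; [:: c; d]] i) j.

Lemma det_mx22 (F : comNzRingType) (A : 'M[F]_2) :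
  \det A = A 0 0 * A 1 1 - A 0 1 * A 1 0.
Proof.
rewrite (expand_det_row _ 0) !big_ord_recl big_ord0 addr0 /cofactor !det_mx11.
rewrite !mxE /= expr0 expr1 mul1r mulN1r mulrN.
by congr (_ * A _ _ - A _ _ * A _ _); apply: val_inj.
Qed.

Section SL2.
Variable F : fieldType.

Record SL2 := MkSL2 { sl2mx :> 'M[F]_2; _ : \det sl2mx == 1 }.
HB.instance Definition _ := [isSub for sl2mx].
HB.instance Definition _ := [Choice of SL2 by <:].
Implicit Types A B C : SL2.

Lemma sl2_det A : \det A = 1. Proof. by case: A => A /= /eqP. Qed.

Lemma sl2_unit A : sl2mx A \in unitmx.
Proof. by rewrite unitmxE sl2_det unitr1. Qed.

Fact sl2_one_subproof : \det (1%:M : 'M[F]_2) == 1.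
Proof. by rewrite det1. Qed.
Fact sl2_mul_subproof A B : \det (A *m B) == 1.
Proof. by rewrite det_mulmx !sl2_det mul1r. Qed.
Fact sl2_inv_subproof A : \det (invmx A) == 1.
Proof. by rewrite det_inv sl2_det invr1. Qed.

Definition sl2_one := MkSL2 sl2_one_subproof.
Definition sl2_mul A B := MkSL2 (sl2_mul_subproof A B).
Definition sl2_inv A := MkSL2 (sl2_inv_subproof A).

Fact sl2_mulA : associative sl2_mul.
Proof. by move=> A B C; apply/val_inj; rewrite /= mulmxA. Qed.
Fact sl2_mul1 : left_id sl2_one sl2_mul.
Proof. by move=> A; apply/val_inj; rewrite /= mul1mx. Qed.
Fact sl2_mulr1 : right_id sl2_one sl2_mul.
Proof. by move=> A; apply/val_inj; rewrite /= mulmx1. Qed.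
Fact sl2_mulV : left_inverse sl2_one sl2_inv sl2_mul.
Proof. by move=> A; apply/val_inj; rewrite /= mulVmx ?sl2_unit. Qed.
Fact sl2_mulrV : right_inverse sl2_one sl2_inv sl2_mul.
Proof. by move=> A; apply/val_inj; rewrite /= mulmxV ?sl2_unit. Qed.

HB.instance Definition _ :=
  isGroup.Build SL2 sl2_mulA sl2_mul1 sl2_mulr1 sl2_mulV sl2_mulrV.

Definition eq_pm A B := (sl2mx A == B) || (sl2mx A == - sl2mx B).

Fact eq_pm_refl : reflexive eq_pm.
Proof. by move=> A; rewrite /eq_pm eqxx. Qed.
Fact eq_pm_sym : symmetric eq_pm.
Proof. by move=> A B; rewrite /eq_pm eq_sym [X in _ || X]eq_sym eqr_oppLR. Qed.
Fact eq_pm_trans : transitive eq_pm.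
Proof.
move=> B A C; rewrite /eq_pm => /orP[] /eqP-> /orP[] /eqP->;
  by rewrite ?opprK eqxx ?orbT.
Qed.

Canonical eq_pm_equiv := EquivRel eq_pm eq_pm_refl eq_pm_sym eq_pm_trans.

Definition PSL2 := {eq_quot eq_pm}.
HB.instance Definition _ : EqQuotient _ eq_pm PSL2 := EqQuotient.on PSL2.
HB.instance Definition _ := Choice.on PSL2.
Implicit Types g h : PSL2.

Definition psl2_one : PSL2 := \pi_PSL2 (1%g : SL2).
Definition psl2_mul g h : PSL2 := \pi_PSL2 (repr g * repr h)%g.
Definition psl2_inv g : PSL2 := \pi_PSL2 ((repr g)^-1)%g.

Lemma eq_pmP A B :
  reflect (sl2mx A = B \/ sl2mx A = - sl2mx B) (\pi_PSL2 A == \pi_PSL2 B).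
Proof. by rewrite piE; apply: (iffP orP) => -[] /eqP; tauto. Qed.

Lemma repr_pm A :
  sl2mx (repr (\pi_PSL2 A)) = A \/ sl2mx (repr (\pi_PSL2 A)) = - sl2mx A.
Proof. by apply/eq_pmP; rewrite reprK. Qed.

Lemma psl2_pi_mul A B : psl2_mul (\pi A) (\pi B) = \pi_PSL2 (A * B)%g.
Proof.
apply/eqP/eq_pmP; rewrite /=; case: (repr_pm A) (repr_pm B) => -> [] ->;
  by rewrite ?mulmxN ?mulNmx ?opprK; auto.
Qed.

Lemma psl2_pi_inv A : psl2_inv (\pi A) = \pi_PSL2 (A^-1)%g.
Proof.
apply/eqP/eq_pmP; rewrite /=; case: (repr_pm A) => ->; first by left.
by right; rewrite -!scaleN1r invmxZ ?invrN1 ?unitmxZ ?unitrN1 ?sl2_unit.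
Qed.

Fact psl2_mulA : associative psl2_mul.
Proof.
by elim/quotW=> A; elim/quotW=> B; elim/quotW=> C; rewrite !psl2_pi_mul mulgA.
Qed.
Fact psl2_mul1 : left_id psl2_one psl2_mul.
Proof. by elim/quotW=> A; rewrite psl2_pi_mul mul1g. Qed.
Fact psl2_mulr1 : right_id psl2_one psl2_mul.
Proof. by elim/quotW=> A; rewrite psl2_pi_mul mulg1. Qed.
Fact psl2_mulV : left_inverse psl2_one psl2_inv psl2_mul.
Proof. by elim/quotW=> A; rewrite psl2_pi_inv psl2_pi_mul mulVg. Qed.
Fact psl2_mulrV : right_inverse psl2_one psl2_inv psl2_mul.
Proof. by elim/quotW=> A; rewrite psl2_pi_inv psl2_pi_mul mulgV. Qed.

HB.instance Definition _ :=
  isGroup.Build PSL2 psl2_mulA psl2_mul1 psl2_mulr1 psl2_mulV psl2_mulrV.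

(* P^1(F) = F u {oo} *)
Variant P1 := Fin of F | Infty.

Definition mobius (A : 'M[F]_2) (x : P1) : P1 :=
  match x with
  | Fin z => if A 1 0 * z + A 1 1 == 0 then Infty
             else Fin ((A 0 0 * z + A 0 1) / (A 1 0 * z + A 1 1))
  | Infty => if A 1 0 == 0 then Infty else Fin (A 0 0 / A 1 0)
  end.

Definition psl2_act (g : PSL2) (x : P1) : P1 := mobius (repr g) x.

Lemma mobiusN (A : 'M[F]_2) : mobius (- A) = mobius A.
Proof.
apply/funext => -[z|]; rewrite /= !mxE.
  by rewrite !mulNr -!opprD oppr_eq0 invrN mulrNN.
by rewrite oppr_eq0 invrN mulrNN.
Qed.

Lemma psl2_actE A x : psl2_act (\pi_PSL2 A) x = mobius A x.
Proof. by rewrite /psl2_act; case: (repr_pm A) => ->; rewrite ?mobiusN. Qed.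

End SL2.
Arguments Infty {F}.

Section Subgroups.
Variable G : groupType.
Implicit Types H K : set G.
Local Open Scope group_scope.

Definition is_subgroup H :=
  [/\ H 1, forall x y, H x -> H y -> H (x * y) & forall x, H x -> H x^-1].

Definition generated (S : set G) : set G := smallest is_subgroup S.

Definition finite_index K H := finite_set [set [set h * k | k in K] | h in H].

Definition commensurable H K :=
  finite_index (H `&` K) H /\ finite_index (H `&` K) K.

End Subgroups.

Section Cusps.
Variable R : realType.
Implicit Types G : set (PSL2 R).

(* Over R, an element of PSL2 has exactly one fixed point on P^1(R) iff it is
   parabolic. *)
Definition cusps G : set (P1 R) :=
  [set x | exists2 g, G g & forall y, psl2_act g y = y <-> y = x].

Definition finite_cusps G : set R := [set x | cusps G (Fin x)].

Definition PSL2Z : set (PSL2 R) :=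
  [set \pi_(PSL2 R) A | A in [set A : SL2 R | forall i j, A i j \is a Num.int]].

Definition P1Q : set (P1 R) := Infty |` [set Fin (ratr q) | q in [set: rat]].

(* Both notions are meant for Fuchsian groups of finite coarea, such as the
   groups Delta below. *)
Definition arithmetic G := commensurable G PSL2Z.

Definition pseudomodular G := ~ arithmetic G /\ cusps G = P1Q.

End Cusps.

(* Delta R (u2 := u^2) (t := t) is the group Delta(u^2, 2t): the parameter t is
   half of the second entry. *)
Section Delta.
Variables (R : realType) (u2 t : rat).

Definition g1mx : 'M[R]_2 :=
  (Num.sqrt (ratr (-1 + t - u2)))^-1 *:
    mx22 (ratr (t - 1)) (ratr u2)
         1              1.

Definition g2mx : 'M[R]_2 :=
  (Num.sqrt (ratr u2) * Num.sqrt (ratr (-1 + t - u2)))^-1 *: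
    mx22 (ratr u2) (ratr u2)
         1         (ratr (t - u2)).

Hypothesis ut : 0 < u2 < t - 1.

Let s_gt0 : 0 < ratr (-1 + t - u2) :> R.
Proof. by have /andP[? ?] := ut; rewrite ltr0q; lra. Qed.

Lemma det_g1 : \det g1mx == 1.
Proof.
rewrite detZ det_mx22 !mxE /= exprVn sqr_sqrtr ?ltW //.
rewrite !mulr1 -rmorphB /= (_ : t - 1 - u2 = -1 + t - u2); last by ring.
by rewrite mulVf // gt_eqF.
Qed.

Lemma det_g2 : \det g2mx == 1.
Proof.
have u_gt0 : 0 < ratr u2 :> R by have /andP[? ?] := ut; rewrite ltr0q.
rewrite detZ det_mx22 !mxE /= exprVn exprMn !sqr_sqrtr ?ltW //.
have -> : ratr (t - u2) = ratr (-1 + t - u2) + 1 :> R.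
  by rewrite !rmorphB rmorphD rmorphN1; ring.
move: (ratr _) (ratr _) s_gt0 u_gt0 => s v s_gt0' v_gt0.
by apply/eqP; field; rewrite !gt_eqF.
Qed.

Definition Delta : set (PSL2 R) :=
  generated [set \pi_(PSL2 R) (MkSL2 det_g1); \pi_(PSL2 R) (MkSL2 det_g2)].

End Delta.
Arguments Delta R {u2 t} ut.

(* The projective limit of the rings Z/N: the component of index n lives in
   Z/(n+2); the zero ring Z/1 is left out. *)
Record Zhat := MkZhat {
  zcomp :> forall n, 'I_n.+2;
  _ : forall m n, (m.+2 %| n.+2)%N -> (zcomp n = zcomp m %[mod m.+2])%N }.

HB.instance Definition _ := gen_eqMixin Zhat.
HB.instance Definition _ := gen_choiceMixin Zhat.

Lemma zhatP (x y : Zhat) : (forall n, x n = y n) -> x = y.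
Proof.
case: x y => [x xP] [y yP] /= exy.
have {}exy : x = y by apply: functional_extensionality_dep.
by subst y; congr MkZhat; apply: Prop_irrelevance.
Qed.

Section Reduction.
Variables m n : nat.
Implicit Types a b : 'I_n.+2.

Definition zred (a : 'I_n.+2) : 'I_m.+2 := (a : nat)%:R.

Lemma eqmod_zred a (c : 'I_m.+2) : (a = c %[mod m.+2])%N <-> zred a = c.
Proof.
rewrite /zred Zp_nat (modn_small (ltn_ord c)); split=> [ac|<- //].
exact: val_inj.
Qed.

Lemma zhat_red (x : Zhat) : (m.+2 %| n.+2)%N -> zred (x n) = x m.
Proof. by case: x => x xP /= /xP /eqmod_zred. Qed.

Hypothesis dv : (m.+2 %| n.+2)%N.

Lemma zred_nat k : zred (k%:R : 'I_n.+2) = k%:R.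
Proof. by apply: val_inj; rewrite /zred !Zp_nat /= modn_dvdm. Qed.

Lemma zredD a b : zred (a + b) = zred a + zred b.
Proof.
have -> : a + b = (a + b)%N%:R by rewrite natrD !natr_Zp.
by rewrite zred_nat natrD.
Qed.

Lemma zredM a b : zred (a * b) = zred a * zred b.
Proof.
have -> : a * b = (a * b)%N%:R by rewrite natrM !natr_Zp.
by rewrite zred_nat natrM.
Qed.

Lemma zredN a : zred (- a) = - zred a.
Proof. by apply: (addrI (zred a)); rewrite -zredD !subrr. Qed.

End Reduction.

Section ZhatRing.
Implicit Types x y z : Zhat.

Fact zhat_nat_subproof k m n : (m.+2 %| n.+2)%N ->
  ((k%:R : 'I_n.+2) = (k%:R : 'I_m.+2) %[mod m.+2])%N.
Proof. by move=> dv; apply/eqmod_zred; rewrite zred_nat. Qed.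
Fact zhat_add_subproof x y m n : (m.+2 %| n.+2)%N ->
  ((x n + y n)%R = (x m + y m)%R %[mod m.+2])%N.
Proof. by move=> dv; apply/eqmod_zred; rewrite zredD ?zhat_red. Qed.
Fact zhat_opp_subproof x m n : (m.+2 %| n.+2)%N ->
  ((- x n)%R = (- x m)%R %[mod m.+2])%N.
Proof. by move=> dv; apply/eqmod_zred; rewrite zredN ?zhat_red. Qed.
Fact zhat_mul_subproof x y m n : (m.+2 %| n.+2)%N ->
  ((x n * y n)%R = (x m * y m)%R %[mod m.+2])%N.
Proof. by move=> dv; apply/eqmod_zred; rewrite zredM ?zhat_red. Qed.

Definition zhat_nat k := MkZhat (zhat_nat_subproof k).
Definition zhat_add x y := MkZhat (zhat_add_subproof x y).
Definition zhat_opp x := MkZhat (zhat_opp_subproof x).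
Definition zhat_mul x y := MkZhat (zhat_mul_subproof x y).

Fact zhat_addA : associative zhat_add.
Proof. by move=> x y z; apply: zhatP => n; apply: addrA. Qed.
Fact zhat_addC : commutative zhat_add.
Proof. by move=> x y; apply: zhatP => n; apply: addrC. Qed.
Fact zhat_add0 : left_id (zhat_nat 0) zhat_add.
Proof. by move=> x; apply: zhatP => n; apply: add0r. Qed.
Fact zhat_addN : left_inverse (zhat_nat 0) zhat_opp zhat_add.
Proof. by move=> x; apply: zhatP => n; apply: addNr. Qed.

HB.instance Definition _ :=
  GRing.isZmodule.Build Zhat zhat_addA zhat_addC zhat_add0 zhat_addN.

Fact zhat_mulA : associative zhat_mul.
Proof. by move=> x y z; apply: zhatP => n; apply: mulrA. Qed.
Fact zhat_mulC : commutative zhat_mul.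
Proof. by move=> x y; apply: zhatP => n; apply: mulrC. Qed.
Fact zhat_mul1 : left_id (zhat_nat 1) zhat_mul.
Proof. by move=> x; apply: zhatP => n; apply: mul1r. Qed.
Fact zhat_mulD : left_distributive zhat_mul zhat_add.
Proof. by move=> x y z; apply: zhatP => n; apply: mulrDl. Qed.
Fact zhat_1neq0 : zhat_nat 1 != 0.
Proof. by apply/eqP => /(congr1 (fun x : Zhat => val (x 0%N))). Qed.

HB.instance Definition _ := GRing.Zmodule_isComNzRing.Build Zhat
  zhat_mulA zhat_mulC zhat_mul1 zhat_mulD zhat_1neq0.

Lemma zhat_natE k n : (k%:R : Zhat) n = k%:R.
Proof.
elim: k => [//|k IHk]; rewrite -[in RHS]natr1 -natr1.
by rewrite -IHk.
Qed.

Lemma zhat_torsion_free (d : int) x y :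
  d != 0 -> d%:~R * x = d%:~R * y -> x = y.
Proof.
move=> d0 /eqP; rewrite -subr_eq0 -mulrBr => /eqP dxy.
apply/eqP; rewrite -subr_eq0; apply/eqP; move: (x - y) dxy => {x y} z dz.
have {dz} kz : `|d|%N%:R * z = 0.
  by rewrite -[_%:R]/(`|d|%N%:~R) abszE normrEsg intrM -mulrA dz mulr0.
have {d0} : (0 < `|d|)%N by rewrite absz_gt0.
move: {d}`|d|%N kz => k kz k0; apply: zhatP => n.
have e : ((k * n.+2).-2.+2 = k * n.+2)%N.
  by case: k k0 {kz} => // k _; rewrite mulSn /= !addSn.
rewrite -(zhat_red z (n := (k * n.+2).-2)) ?e ?dvdn_mull //.
move/(congr1 (fun x : Zhat => val (x (k * n.+2).-2))): kz.
have -> : (k%:R * z) (k * n.+2).-2 = (k * z (k * n.+2).-2)%N%:R.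
  by rewrite natrM natr_Zp -zhat_natE.
rewrite Zp_nat /= [X in (_ %% X)%N]e => /eqP.
rewrite -muln_modr muln_eq0 -leqn0 leqNgt k0 /=.
by move=> /eqP zn; apply: val_inj; rewrite /zred Zp_nat /= zn.
Qed.

End ZhatRing.

Section FiniteAdeles.

(* Q (x) Zhat. By clearing denominators every element is a pure tensor, and as
   Zhat has no torsion, q (x) x = r (x) y iff the two integral multiples by the
   product of the denominators of q and r agree in Zhat. The universal property
   is tensor_univ below. *)
Definition pretensor := (rat * Zhat)%type.
Implicit Types (p : pretensor) (q r : rat) (x y : Zhat).

Definition eq_tensor p1 p2 :=
  (numq p1.1 * denq p2.1)%:~R * p1.2 == (numq p2.1 * denq p1.1)%:~R * p2.2.

Fact eq_tensor_refl : reflexive eq_tensor.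
Proof. by move=> p; rewrite /eq_tensor eqxx. Qed.
Fact eq_tensor_sym : symmetric eq_tensor.
Proof. by move=> p1 p2; rewrite /eq_tensor eq_sym. Qed.

Lemma eq_tensorP (p1 p2 : pretensor) (a b d : int) :
  d != 0 -> p1.1 = a%:~R / d%:~R -> p2.1 = b%:~R / d%:~R ->
  eq_tensor p1 p2 = (a%:~R * p1.2 == b%:~R * p2.2).
Proof.
case: p1 p2 => [q x] [r y] /= d0 qE rE.
have qa : numq q * d = a * denq q.
  apply: (@intr_inj rat); rewrite !intrM numqE qE; field.
  by rewrite intr_eq0.
have rb : numq r * d = b * denq r.
  apply: (@intr_inj rat); rewrite !intrM numqE rE; field.
  by rewrite intr_eq0.
apply/eqP/eqP => /= H.
  apply: (@zhat_torsion_free (denq q * denq r)).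
    by rewrite mulf_neq0 ?denq_neq0.
  transitivity ((a * denq q)%:~R * (denq r)%:~R * x); first by ring.
  rewrite -qa.
  transitivity (d%:~R * ((numq q * denq r)%:~R * x)); first by ring.
  rewrite H; transitivity ((numq r * d)%:~R * (denq q)%:~R * y); first by ring.
  by rewrite rb; ring.
apply: (zhat_torsion_free d0).
transitivity ((numq q * d)%:~R * (denq r)%:~R * x); first by ring.
rewrite qa; transitivity ((denq q * denq r)%:~R * (a%:~R * x)); first by ring.
rewrite H; transitivity ((b * denq r)%:~R * (denq q)%:~R * y); first by ring.
by rewrite -rb; ring.
Qed.

Fact eq_tensor_trans : transitive eq_tensor.
Proof.
move=> [q2 x2] [q1 x1] [q3 x3] /=; rewrite /eq_tensor /= => /eqP H12 /eqP H23.
apply/eqP/(@zhat_torsion_free (denq q2)); first exact: denq_neq0.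
transitivity ((denq q3)%:~R * ((numq q1 * denq q2)%:~R * x1)); first by ring.
rewrite H12.
transitivity ((denq q1)%:~R * ((numq q2 * denq q3)%:~R * x2)); first by ring.
by rewrite H23; ring.
Qed.

Canonical eq_tensor_equiv :=
  EquivRel eq_tensor eq_tensor_refl eq_tensor_sym eq_tensor_trans.

Definition finadele := {eq_quot eq_tensor}.
HB.instance Definition _ : EqQuotient _ eq_tensor finadele :=
  EqQuotient.on finadele.
HB.instance Definition _ := Choice.on finadele.

Definition tensor q x : finadele := \pi_finadele (q, x).

Lemma tensorW (P : finadele -> Prop) :
  (forall q x, P (tensor q x)) -> forall a, P a.
Proof. by move=> PT a; elim/quotW: a => -[q x]; apply: PT. Qed.

Lemma tensor_eq q x r y (a b d : int) : d != 0 ->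
    q = a%:~R / d%:~R -> r = b%:~R / d%:~R ->
  tensor q x = tensor r y <-> a%:~R * x = b%:~R * y.
Proof.
move=> d0 qE rE; split=> [/eqmodP|] H.
  by move: H; rewrite /= (@eq_tensorP (q, x) (r, y) _ _ _ d0 qE rE) => /eqP.
by apply/eqmodP; rewrite /= (@eq_tensorP (q, x) (r, y) _ _ _ d0 qE rE) /= H.
Qed.

Lemma tensorZ q (k : int) x : tensor q (k%:~R * x) = tensor (q * k%:~R) x.
Proof.
apply/(@tensor_eq _ _ _ _ (numq q) (numq q * k) (denq q)).
- exact: denq_neq0.
- by rewrite divq_num_den.
- by rewrite intrM -[in LHS](divq_num_den q) mulrAC.
- by ring.
Qed.

Definition adele_add_pre p1 p2 : pretensor :=
  (((denq p1.1 * denq p2.1)%:~R)^-1,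
   (numq p1.1 * denq p2.1)%:~R * p1.2 + (numq p2.1 * denq p1.1)%:~R * p2.2).

Definition adele_add (a b : finadele) : finadele :=
  \pi_finadele (adele_add_pre (repr a) (repr b)).
Definition adele_opp (a : finadele) := tensor (repr a).1 (- (repr a).2).
Definition adele_mul (a b : finadele) :=
  tensor ((repr a).1 * (repr b).1) ((repr a).2 * (repr b).2).

Lemma tensor_repr q x : exists r y, repr (tensor q x) = (r, y) /\
  (numq q * denq r)%:~R * x = (numq r * denq q)%:~R * y.
Proof.
case E: (repr (tensor q x)) => [r y]; exists r, y; split=> //.
have /eqmodP /= : \pi_finadele (q, x) = \pi_finadele (r, y) by rewrite -E reprK.
by rewrite /eq_tensor => /eqP.
Qed.

Lemma denqr_neq0 q : (denq q)%:~R != 0 :> rat.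
Proof. by rewrite intr_eq0 denq_neq0. Qed.

Lemma adele_addE q x r y : adele_add (tensor q x) (tensor r y) =
  \pi_finadele (adele_add_pre (q, x) (r, y)).
Proof.
rewrite /adele_add.
have [q' [x' [-> Hx]]] := tensor_repr q x.
have [r' [y' [-> Hy]]] := tensor_repr r y.
apply/(@tensor_eq _ _ _ _ (denq q * denq r) (denq q' * denq r')
  (denq q * denq r * (denq q' * denq r'))) => /=.
- by rewrite !mulf_neq0 ?denq_neq0.
- by rewrite !intrM; field; rewrite !denqr_neq0.
- by rewrite !intrM; field; rewrite !denqr_neq0.
transitivity ((denq r' * denq r)%:~R * ((numq q' * denq q)%:~R * x')
   + (denq q' * denq q)%:~R * ((numq r' * denq r)%:~R * y')); first by ring.
by rewrite -Hx -Hy; ring.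
Qed.

Lemma adele_mulE q x r y :
  adele_mul (tensor q x) (tensor r y) = tensor (q * r) (x * y).
Proof.
rewrite /adele_mul.
have [q' [x' [-> Hx]]] := tensor_repr q x.
have [r' [y' [-> Hy]]] := tensor_repr r y.
apply/(@tensor_eq _ _ _ _ (numq q' * numq r' * (denq q * denq r))
  (numq q * numq r * (denq q' * denq r'))
  (denq q * denq r * (denq q' * denq r'))) => /=.
- by rewrite !mulf_neq0 ?denq_neq0.
- by rewrite -[q' in LHS]divq_num_den -[r' in LHS]divq_num_den !intrM;
    field; rewrite !denqr_neq0.
- by rewrite -[q in LHS]divq_num_den -[r in LHS]divq_num_den !intrM;
    field; rewrite !denqr_neq0.
transitivity (((numq q' * denq q)%:~R * x') * ((numq r' * denq r)%:~R * y')).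
  by ring.
by rewrite -Hx -Hy; ring.
Qed.

Lemma adele_oppE q x : adele_opp (tensor q x) = tensor q (- x).
Proof.
rewrite /adele_opp; have [q' [x' [-> Hx]]] := tensor_repr q x.
apply/(@tensor_eq _ _ _ _ (numq q' * denq q) (numq q * denq q')
  (denq q * denq q')) => /=.
- by rewrite !mulf_neq0 ?denq_neq0.
- by rewrite -[q' in LHS]divq_num_den !intrM; field; rewrite !denqr_neq0.
- by rewrite -[q in LHS]divq_num_den !intrM; field; rewrite !denqr_neq0.
by rewrite !mulrN Hx.
Qed.

Lemma adele_addDr q x y :
  adele_add (tensor q x) (tensor q y) = tensor q (x + y).
Proof.
rewrite adele_addE.
apply/(@tensor_eq _ _ _ _ 1 (numq q * denq q) (denq q * denq q)) => /=.
- by rewrite mulf_neq0 ?denq_neq0.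
- by rewrite mul1r.
- by rewrite -[q in LHS]divq_num_den !intrM; field; rewrite !denqr_neq0.
by ring.
Qed.

Lemma tensor_common (a b : finadele) :
  exists q x y, a = tensor q x /\ b = tensor q y.
Proof.
elim/tensorW: a => q x; elim/tensorW: b => r y.
exists (denq q * denq r)%:~R^-1, ((numq q * denq r)%:~R * x),
  ((numq r * denq q)%:~R * y).
by split; rewrite tensorZ; congr tensor;
  [rewrite -[q in LHS]divq_num_den | rewrite -[r in LHS]divq_num_den];
  rewrite !intrM; field; rewrite !denqr_neq0.
Qed.

Lemma tensor_common3 (a b c : finadele) : exists q x y z,
  [/\ a = tensor q x, b = tensor q y & c = tensor q z].
Proof.
have [q [x [y [-> ->]]]] := tensor_common a b.
elim/tensorW: c => r z.
exists (denq q * denq r)%:~R^-1, ((numq q * denq r)%:~R * x),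
  ((numq q * denq r)%:~R * y), ((numq r * denq q)%:~R * z).
by split; rewrite tensorZ; congr tensor;
  [rewrite -[q in LHS]divq_num_den | rewrite -[q in LHS]divq_num_den
  | rewrite -[r in LHS]divq_num_den];
  rewrite !intrM; field; rewrite !denqr_neq0.
Qed.

Lemma tensor0 q : tensor q 0 = tensor 1 0.
Proof.
apply/(@tensor_eq _ _ _ _ (numq q) (denq q) (denq q)).
- exact: denq_neq0.
- by rewrite divq_num_den.
- by rewrite divff ?denqr_neq0.
by rewrite !mulr0.
Qed.

Fact adele_addA : associative adele_add.
Proof.
move=> a b c; have [q [x [y [z [-> -> ->]]]]] := tensor_common3 a b c.
by rewrite !adele_addDr addrA.
Qed.
Fact adele_addC : commutative adele_add.
Proof.
move=> a b; have [q [x [y [-> ->]]]] := tensor_common a b.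
by rewrite !adele_addDr addrC.
Qed.
Fact adele_add0 : left_id (tensor 1 0) adele_add.
Proof. by elim/tensorW=> q x; rewrite -(tensor0 q) adele_addDr add0r. Qed.
Fact adele_addN : left_inverse (tensor 1 0) adele_opp adele_add.
Proof.
by elim/tensorW=> q x; rewrite adele_oppE adele_addDr addNr tensor0.
Qed.

HB.instance Definition _ :=
  GRing.isZmodule.Build finadele adele_addA adele_addC adele_add0 adele_addN.

Fact adele_mulA : associative adele_mul.
Proof.
elim/tensorW=> q x; elim/tensorW=> r y; elim/tensorW=> s z.
by rewrite !adele_mulE !mulrA; congr tensor.
Qed.
Fact adele_mulC : commutative adele_mul.
Proof.
elim/tensorW=> q x; elim/tensorW=> r y.
by rewrite !adele_mulE [q * r]mulrC [x * y]mulrC.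
Qed.
Fact adele_mul1 : left_id (tensor 1 1) adele_mul.
Proof. by elim/tensorW=> q x; rewrite adele_mulE !mul1r. Qed.
Fact adele_mulD : left_distributive adele_mul adele_add.
Proof.
move=> a b; elim/tensorW=> r z.
have [q [x [y [-> ->]]]] := tensor_common a b.
by rewrite !(adele_addDr, adele_mulE) mulrDl.
Qed.
Fact adele_1neq0 : tensor 1 1 != 0.
Proof.
apply/eqP => H; have := (@tensor_eq 1 1 1 0 1 1 1 isT erefl erefl).1 H.
by rewrite !mul1r => /eqP; rewrite oner_eq0.
Qed.

HB.instance Definition _ := GRing.Zmodule_isComNzRing.Build finadele
  adele_mulA adele_mulC adele_mul1 adele_mulD adele_1neq0.

Lemma tensorDr q x y : tensor q (x + y) = tensor q x + tensor q y.
Proof. by rewrite -adele_addDr. Qed.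

Lemma rat_common q r :
  exists (e : rat) (i j : int), q = e * i%:~R /\ r = e * j%:~R.
Proof.
exists (denq q * denq r)%:~R^-1, (numq q * denq r), (numq r * denq q).
split; [rewrite -[q in LHS]divq_num_den | rewrite -[r in LHS]divq_num_den];
  by rewrite !intrM; field; rewrite !denqr_neq0.
Qed.

Lemma tensorDl q r x : tensor (q + r) x = tensor q x + tensor r x.
Proof.
have [e [i [j [-> ->]]]] := rat_common q r.
by rewrite -mulrDr -intrD -!tensorZ -tensorDr intrD mulrDl.
Qed.

Lemma tensorM q r x y : tensor (q * r) (x * y) = tensor q x * tensor r y.
Proof. by rewrite -adele_mulE. Qed.

Lemma additive_mulz (U V : zmodType) (h : U -> V) :
  (forall x y : U, h (x + y) = h x + h y) ->
  forall (x : U) (i : int), h (x *~ i) = h x *~ i.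
Proof.
move=> hD x; have h0 : h 0 = 0 by apply: (addrI (h 0)); rewrite -hD !addr0.
have hN (y : U) : h (- y) = - h y by apply: (addrI (h y)); rewrite -hD !subrr.
have hn n : h (x *+ n) = h x *+ n.
  by elim: n => [|n IHn]; rewrite ?mulr0n // !mulrS hD IHn.
by case=> n; rewrite ?NegzE ?mulrNz ?hN -!pmulrn hn.
Qed.

Lemma tensor_univ (V : zmodType) (f : rat -> Zhat -> V) :
  (forall q r x, f (q + r) x = f q x + f r x) ->
  (forall q x y, f q (x + y) = f q x + f q y) ->
  exists! g : finadele -> V,
    (forall a b, g (a + b) = g a + g b) /\ (forall q x, g (tensor q x) = f q x).
Proof.
move=> fDl fDr.
have fZ q (i : int) x : f (q * i%:~R) x = f q (i%:~R * x).
  rewrite mulrzr mulrzl (additive_mulz (fDr q)).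
  by rewrite (additive_mulz (fun q r => fDl q r x)).
have gE q x : f (repr (tensor q x)).1 (repr (tensor q x)).2 = f q x.
  have [r [y [-> H]]] := tensor_repr q x; rewrite /=.
  have -> : r = (denq q * denq r)%:~R^-1 * (numq r * denq q)%:~R.
    by rewrite -[r in LHS]divq_num_den !intrM; field; rewrite !denqr_neq0.
  have {3}-> : q = (denq q * denq r)%:~R^-1 * (numq q * denq r)%:~R.
    by rewrite -[q in LHS]divq_num_den !intrM; field; rewrite !denqr_neq0.
  by rewrite !fZ H.
exists (fun a => f (repr a).1 (repr a).2); split; first split=> //.
  move=> a b; have [q [x [y [-> ->]]]] := tensor_common a b.
  by rewrite -tensorDr !gE.
by move=> g [_ gT]; apply/funext; elim/tensorW => q x; rewrite gT gE.
Qed.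

(* The diagonal embedding of Q. *)
Definition adele_of_rat q : finadele := tensor q 1.

(* The subgroup m Zhat. *)
Definition scaledZhat (m : rat) : set finadele := range (tensor m).

Definition adele_nbhs (a : finadele) : set_system finadele :=
  [set U | exists2 m, m != 0 & [set a + b | b in scaledZhat m] `<=` U].

HB.instance Definition _ := hasNbhs.Build finadele adele_nbhs.

Lemma scaledZhat_int q (k : int) :
  scaledZhat (q * k%:~R) `<=` scaledZhat q.
Proof. by move=> _ [x _ <-]; rewrite -tensorZ; exists (k%:~R * x). Qed.

Fact adele_nbhs_filter (a : finadele) : ProperFilter (nbhs a).
Proof.
split.
  move=> [m _ /(_ a)]; apply; exists 0; last by rewrite addr0.
  by exists 0 => //; rewrite tensor0.
split.
- by exists 1.
- move=> U V [m + mU] [n + nV]; have [e [i [j [mE nE]]]] := rat_common m n.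
  rewrite mE nE !mulf_eq0 !negb_or => /andP[e0 i0] /andP[_ j0].
  exists (e * i%:~R * j%:~R); first by rewrite !mulf_neq0.
  move=> _ [b bE <-]; split; [apply: mU | apply: nV]; exists b => //.
    by rewrite mE; apply: scaledZhat_int bE.
  by rewrite nE; rewrite mulrAC in bE; apply: scaledZhat_int bE.
- by move=> U V UV [m m0 mU]; exists m => //; apply: subset_trans UV.
Qed.

Fact adele_nbhs_singleton (a : finadele) (U : set finadele) : nbhs a U -> U a.
Proof.
move=> [m _]; apply; exists 0; last by rewrite addr0.
by exists 0 => //; rewrite tensor0.
Qed.

Fact adele_nbhs_nbhs (a : finadele) (U : set finadele) :
  nbhs a U -> nbhs a (nbhs^~ U).
Proof.
move=> [m m0 mU]; exists m => // _ [_ [x _ <-] <-]; exists m => //.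
move=> _ [_ [y _ <-] <-]; apply: mU; exists (tensor m (x + y)).
  by exists (x + y).
by rewrite tensorDr addrA.
Qed.

HB.instance Definition _ := Nbhs_isNbhsTopological.Build finadele
  adele_nbhs_filter adele_nbhs_singleton adele_nbhs_nbhs.

End FiniteAdeles.

(* Main.v *)
(* The commutator of the two generators is the translation by 2t, so the finite
   cusps of Delta are stable under 2tZ. As Q meets Zhat in Z, a rational q lies
   in the same 2tZ-coset as any cusp of the open set q + 2t Zhat; density
   therefore makes every rational a cusp. All cusps are rational because Delta
   consists of rational matrices up to scaling. Conversely Q is dense in the
   finite adeles, and a group commensurable with PSL2(Z) has the same cusps. *)
Require Import Defs.
From mathcomp Require Import all_boot all_order all_algebra.
From mathcomp Require Import ring lra.
From mathcomp Require Import all_classical reals topology_structure.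
Set Implicit Arguments.
Unset Strict Implicit.
Unset Printing Implicit Defensive.
Import Order.TTheory GRing.Theory Num.Theory.

Local Open Scope classical_set_scope.
Local Open Scope ring_scope.
Local Open Scope quotient_scope.

(** * Entrywise calculus of 2 by 2 matrices *)

Section Matrix22.
Variable F : fieldType.
Implicit Types (A B : 'M[F]_2) (S : SL2 F).

Lemma ord2P (P : 'I_2 -> Prop) : P 0 -> P 1 -> forall i, P i.
Proof.
move=> P0 P1 [[|[|i]] lt_i2] //.
  by rewrite (_ : Ordinal lt_i2 = 0) //; apply: val_inj.
by rewrite (_ : Ordinal lt_i2 = 1) //; apply: val_inj.
Qed.

Lemma eq_mx22 A B : A 0 0 = B 0 0 -> A 0 1 = B 0 1 -> A 1 0 = B 1 0 ->
  A 1 1 = B 1 1 -> A = B.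
Proof. by move=> e00 e01 e10 e11; apply/matrixP; do 2![apply: ord2P]. Qed.

Lemma mulmx22E A B i j : (A *m B) i j = A i 0 * B 0 j + A i 1 * B 1 j.
Proof.
rewrite mxE !big_ord_recl big_ord0 addr0.
by rewrite (_ : lift ord0 ord0 = 1) //; apply: val_inj.
Qed.

(** With determinant one the inverse is the adjugate; explicit entries allow identities with
    inverses to be checked entry by entry. *)
Lemma invmx22 S : invmx S = mx22 (S 1 1) (- S 0 1) (- S 1 0) (S 0 0).
Proof.
set C := mx22 _ _ _ _.
have SC : sl2mx S *m C = 1%:M.
  have := sl2_det S; rewrite det_mx22 => dS.
  by apply: eq_mx22; rewrite mulmx22E !mxE /= -?[in RHS]dS; ring.
by rewrite -[LHS]mulmx1 -SC mulKmx ?sl2_unit.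
Qed.

End Matrix22.

(** * The Möbius action in homogeneous coordinates *)

Section Mobius.
Variable F : fieldType.
Implicit Types (A B : 'M[F]_2) (g h : PSL2 F) (x y : P1 F).

(* The point [p : r] of P^1, meaningful when (p, r) != (0, 0). *)
Definition hpoint (p r : F) : P1 F := if r == 0 then Infty else Fin (p / r).

Lemma hpointP x :
  exists p r, [/\ x = hpoint p r & (p != 0) || (r != 0)].
Proof.
case: x => [z|]; [exists z, 1 | exists 1, 0]; rewrite /hpoint ?eqxx oner_eq0.
  by rewrite divr1 orbT.
by [].
Qed.

(** In homogeneous coordinates the action is linear, so composition can be handled without
    separating the point at infinity. *)
Lemma mobius_hpoint A p r : (p != 0) || (r != 0) ->
  mobius A (hpoint p r) =
  hpoint (A 0 0 * p + A 0 1 * r) (A 1 0 * p + A 1 1 * r).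
Proof.
rewrite /hpoint; have [-> /=|r0 _] := eqVneq r 0.
  rewrite orbF !mulr0 !addr0 => p0; rewrite mulf_eq0 (negPf p0) orbF.
  by case: eqVneq => // c0; congr Fin; field; rewrite p0.
rewrite /= (_ : A 1 0 * (p / r) + A 1 1 = (A 1 0 * p + A 1 1 * r) / r);
  last by field.
rewrite mulf_eq0 invr_eq0 (negPf r0) orbF; case: eqVneq => // d0.
by congr Fin; field; rewrite d0 r0.
Qed.

Lemma mobiusM A B x : \det B != 0 -> mobius (A *m B) x = mobius A (mobius B x).
Proof.
rewrite det_mx22 => dB; have [p [r [-> pr]]] := hpointP x.
rewrite !mobius_hpoint // ?mulmx22E; first by congr hpoint; ring.
apply: contraT; rewrite negb_or !negbK => /andP[/eqP e0 /eqP e1].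
(* The adjugate of [B], applied to the vanishing image, returns [\det B] times [(p, r)], so both
   coordinates are zero. *)
have dp : (B 0 0 * B 1 1 - B 0 1 * B 1 0) * p = 0.
  transitivity (B 1 1 * (B 0 0 * p + B 0 1 * r)
                - B 0 1 * (B 1 0 * p + B 1 1 * r)); first by ring.
  by rewrite e0 e1; ring.
have dr : (B 0 0 * B 1 1 - B 0 1 * B 1 0) * r = 0.
  transitivity (B 0 0 * (B 1 0 * p + B 1 1 * r)
                - B 1 0 * (B 0 0 * p + B 0 1 * r)); first by ring.
  by rewrite e0 e1; ring.
move/eqP: dp; move/eqP: dr; rewrite !mulf_eq0 (negPf dB) /= => /eqP r0 /eqP p0.
by move: pr; rewrite r0 p0 eqxx.
Qed.

Lemma mobiusZ (k : F) A : k != 0 -> mobius (k *: A) = mobius A.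
Proof.
move=> k0; apply/funext => -[z|] /=; rewrite !mxE.
  rewrite -!mulrA -!mulrDr mulf_eq0 (negPf k0) /=.
  by case: eqVneq => // d0; congr Fin; field; rewrite k0 d0.
rewrite mulf_eq0 (negPf k0) /=.
by case: eqVneq => // d0; congr Fin; field; rewrite k0 d0.
Qed.

Lemma pi_mulg (A B : SL2 F) :
  (\pi_(PSL2 F) A * \pi_(PSL2 F) B)%g = \pi_(PSL2 F) (A * B)%g.
Proof. exact: psl2_pi_mul. Qed.

Lemma pi_invg (A : SL2 F) :
  ((\pi_(PSL2 F) A)^-1)%g = \pi_(PSL2 F) (A^-1)%g.
Proof. exact: psl2_pi_inv. Qed.

Lemma psl2_actM g h x : psl2_act (g * h)%g x = psl2_act g (psl2_act h x).
Proof.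
rewrite -[(g * h)%g]/(psl2_mul g h) /psl2_mul psl2_actE mobiusM //.
by rewrite sl2_det oner_eq0.
Qed.

Lemma psl2_act1 x : psl2_act 1%g x = x.
Proof.
rewrite -[1%g]/(psl2_one F) /psl2_one psl2_actE /=; case: x => [z|] /=.
  by rewrite !mxE /= mul0r add0r oner_eq0 mul1r addr0 divr1.
by rewrite !mxE /= eqxx.
Qed.

Lemma psl2_actK g x : psl2_act g (psl2_act g^-1%g x) = x.
Proof. by rewrite -psl2_actM mulgV psl2_act1. Qed.

Lemma psl2_actVK g x : psl2_act g^-1%g (psl2_act g x) = x.
Proof. by rewrite -psl2_actM mulVg psl2_act1. Qed.

End Mobius.

(** * Translations and parabolic elements *)

Section Parabolics.
Variable F : fieldType.
Implicit Types (s z : F) (y : P1 F).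

Fact det_trans_subproof s : \det (mx22 1 s 0 1) == 1.
Proof. by rewrite det_mx22 !mxE /=; apply/eqP; ring. Qed.

Definition translation s := MkSL2 (det_trans_subproof s).

Lemma mobius_translation s z : mobius (translation s) (Fin z) = Fin (z + s).
Proof. by rewrite /= !mxE /= mul0r add0r oner_eq0 mul1r divr1. Qed.

Lemma translation_fix s y : s != 0 ->
  psl2_act (\pi_(PSL2 F) (translation s)) y = y <-> y = Infty.
Proof.
move=> s0; rewrite psl2_actE; case: y => [z|].
  rewrite mobius_translation; split=> // -[] /eqP.
  by rewrite -subr_eq0 addrAC subrr add0r (negPf s0).
by rewrite /= !mxE /= eqxx.
Qed.

Fact det_parab_subproof z s :
  \det (mx22 (1 - s * z) (s * z ^+ 2) (- s) (1 + s * z)) == 1.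
Proof. by rewrite det_mx22 !mxE /=; apply/eqP; ring. Qed.

(* The conjugate of [x |-> x / (1 - s x)] by the translation by [z]. *)
Definition parabolic z s := MkSL2 (det_parab_subproof z s).

Lemma parabolicD z s1 s2 :
  (parabolic z s1 * parabolic z s2)%g = parabolic z (s1 + s2).
Proof.
by apply/val_inj; apply: eq_mx22; rewrite /= mulmx22E !mxE /=; ring.
Qed.

Lemma parabolic0 z : parabolic z 0 = 1%g.
Proof. by apply/val_inj; apply: eq_mx22; rewrite /= !mxE /=; ring. Qed.

Lemma parabolicN z s : ((parabolic z s)^-1)%g = parabolic z (- s).
Proof.
apply: (mulgI (parabolic z s)); rewrite mulgV parabolicD subrr.
by rewrite parabolic0.
Qed.

Lemma parabolic_fix z s y : s != 0 ->
  psl2_act (\pi_(PSL2 F) (parabolic z s)) y = y <-> y = Fin z.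
Proof.
move=> s0; rewrite psl2_actE; case: y => [w|]; rewrite /= !mxE /=; last first.
  by rewrite oppr_eq0 (negPf s0).
split=> [|[->]]; last first.
  rewrite (_ : - s * z + (1 + s * z) = 1) ?oner_eq0; last by ring.
  by congr Fin; rewrite divr1; ring.
case: eqVneq => // d0 -[] e; congr Fin.
(* The fixed-point equation has the double root [z]. *)
have : s * (w - z) ^+ 2 = 0.
  transitivity ((1 - s * z) * w + s * z ^+ 2 - w * (- s * w + (1 + s * z))).
    by ring.
  by rewrite -[X in _ - X * _]e divfK // subrr.
by move/eqP; rewrite mulf_eq0 (negPf s0) /= sqrf_eq0 subr_eq0 => /eqP.
Qed.

End Parabolics.

(** * Generated subgroups and cosets of finite index *)

Section Subgroups.
Variable G : groupType.

Lemma generated_subgroup (S : set G) :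
  is_subgroup (generated S).
Proof.
split=> [H [[]]//|x y Sx Sy H HS|x Sx H HS]; have [[_ HM HV] _] := HS.
  by apply: HM; [apply: Sx | apply: Sy].
by apply: HV; apply: Sx.
Qed.

(** Otherwise the cosets [f n K] would be pairwise distinct, infinitely many in a finite set of
    cosets. *)
Lemma finite_index_pigeonhole (K H : set G) (f : nat -> G) :
  K 1%g -> finite_index K H -> (forall n, H (f n)) ->
  exists m n, (m < n)%N /\ K ((f m)^-1 * f n)%g.
Proof.
move=> K1 fin Hf; apply: contrapT => noK.
pose c n := [set (f n * k)%g | k in K].
have lt_neq m n : (m < n)%N -> c m <> c n.
  move=> lt_mn cmn; apply: noK; exists m, n; split=> //.
  have : c m (f n) by rewrite cmn; exists 1%g; rewrite ?mulg1.
  by move=> [k Kk <-]; rewrite mulKg.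
have c_inj : injective c.
  by move=> m n cmn; case: (ltngtP m n) => // /lt_neq; rewrite cmn.
apply: infinite_nat.
have -> : [set: nat] = c @^-1` [set [set (h * k)%g | k in K] | h in H].
  by apply/seteqP; split=> // n _; exists (f n).
by apply: finite_preimage fin => m n _ _; apply: c_inj.
Qed.

End Subgroups.

(** * Stability and rationality of cusps *)

Section Cusps.
Variable R : realType.
Implicit Types (G : set (PSL2 R)) (g h : PSL2 R) (x : P1 R).

(** Conjugation by [g] carries the unique fixed point of [h] to its image under [g]. *)
Lemma cusps_act G g x : is_subgroup G -> G g -> cusps G x ->
  cusps G (psl2_act g x).
Proof.
move=> [_ GM GV] Gg [h Gh hx]; exists (g * h * g^-1)%g.
  by apply: (GM); [apply: GM | apply: GV].
move=> y; rewrite !psl2_actM; split=> [e|->]; last first.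
  by rewrite psl2_actVK (hx x).2.
by rewrite -((hx _).1 (etrans (esym (psl2_actVK g _)) (congr1 _ e))) psl2_actK.
Qed.

(* A parabolic of PSL2(Z) fixing [q] has a nontrivial power in [G]. *)
Lemma arithmetic_cusps G (q : rat) : is_subgroup G -> arithmetic G ->
  cusps G (Fin (ratr q)).
Proof.
move=> [G1 _ _] [_ fin].
pose z : R := ratr q; pose d : R := (denq q)%:~R.
have d0 : d != 0 by rewrite intr_eq0 denq_neq0.
have zE : z = (numq q)%:~R / d by [].
(* The factor [d ^+ 2] clears the denominators of [z] and [z ^+ 2], so [parabolic z (s n)] has
   integer entries. *)
pose s (n : nat) : R := n%:R * d ^+ 2.
pose f n := \pi_(PSL2 R) (parabolic z (s n)).
have Zf n : PSL2Z (f n).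
  exists (parabolic z (s n)) => //; apply: ord2P; apply: ord2P;
    rewrite !mxE /= /s ?zE.
  - rewrite (_ : _ * _ = n%:R * (numq q)%:~R * d); last by field.
    by rewrite rpredB ?rpredM ?rpred1 ?rpred_nat ?intr_int.
  - rewrite (_ : n%:R * d ^+ 2 * _ = n%:R * (numq q)%:~R ^+ 2);
      last by field.
    by rewrite rpredM ?rpredX ?rpred_nat ?intr_int.
  - by rewrite rpredN rpredM ?rpredX ?rpred_nat ?intr_int.
  - rewrite (_ : _ * _ = n%:R * (numq q)%:~R * d); last by field.
    by rewrite rpredD ?rpredM ?rpred1 ?rpred_nat ?intr_int.
have K1 : (G `&` @PSL2Z R) 1%g.
  split=> //; have := Zf 0%N; rewrite /f /s mul0r.
  by rewrite parabolic0.
have [m [n [lt_mn [+ _]]]] := finite_index_pigeonhole K1 fin Zf.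
rewrite pi_invg pi_mulg parabolicN parabolicD => Gmn.
exists (\pi_(PSL2 R) (parabolic z (- s m + s n))) => // y.
apply: parabolic_fix; rewrite addrC -mulrBl mulf_neq0 ?expf_neq0 //.
by rewrite subr_eq0 eqr_nat gtn_eqF.
Qed.

(** The real factor [k] absorbs the square roots in the generators of [Delta]; the Möbius action
    does not see it. *)
Definition rational_psl2 : set (PSL2 R) :=
  [set \pi_(PSL2 R) A | A in [set A : SL2 R | exists (k : R) (M : 'M[rat]_2),
     k != 0 /\ sl2mx A = k *: map_mx ratr M]].

Lemma rational_psl2_subgroup : is_subgroup rational_psl2.
Proof.
split.
- exists 1%g => //; exists 1, 1%:M; rewrite oner_eq0 scale1r map_mx1.
  by split.
- move=> _ _ [A [k [M [k0 AE]]] <-] [B [l [N [l0 BE]]] <-].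
  rewrite pi_mulg; exists (A * B)%g => //; exists (k * l), (M *m N).
  rewrite mulf_neq0 //= AE BE map_mxM -scalemxAl -scalemxAr scalerA.
  by split.
- move=> _ [A [k [M [k0 AE]]] <-]; rewrite pi_invg; exists (A^-1)%g => //.
  (* The adjugate is linear in dimension 2, so the inverse keeps the same factor [k]. *)
  exists k, (mx22 (M 1 1) (- M 0 1) (- M 1 0) (M 0 0)); split=> //.
  rewrite [LHS]invmx22.
  by apply: eq_mx22; rewrite AE !mxE /= ?rmorphN /= ?mulrN.
Qed.

(* If [z] is a root of the fixed-point equation [c z^2 + (d - a) z - b = 0],
   so is [(a - d) / c - z]; uniqueness makes [z] half of a rational. *)
Lemma cusps_rational G : G `<=` rational_psl2 -> cusps G `<=` @P1Q R.
Proof.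
move=> sG [z|] [g /sG[A [k [M [k0 AE]]] <-{g}] fixA]; last by left.
right; have {}fixA y : mobius (map_mx ratr M) y = y <-> y = Fin z.
  by rewrite -fixA psl2_actE AE mobiusZ.
have dM : \det (map_mx ratr M : 'M[R]_2) != 0.
  apply/eqP => dM; have := sl2_det A; rewrite AE detZ dM mulr0 => /esym/eqP.
  by rewrite oner_eq0.
(* A zero lower left entry would make infinity a second fixed point. *)
have := (fixA Infty).1; rewrite /= !mxE; case: eqVneq => [_ /(_ erefl)//|c0 _].
have := (fixA (Fin z)).2 erefl; rewrite /= !mxE; case: eqVneq => // e0 -[] ez.
rewrite det_mx22 !mxE in dM.
have eqz : ratr (M 0 0) * z + ratr (M 0 1) =
    z * (ratr (M 1 0) * z + ratr (M 1 1)) :> R.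
  by apply: esym; rewrite -{1}ez divfK.
pose y := (ratr (M 0 0) - ratr (M 1 1)) / ratr (M 1 0) - z : R.
have eqy : ratr (M 0 0) * y + ratr (M 0 1) =
    y * (ratr (M 1 0) * y + ratr (M 1 1)) :> R.
  have -> : ratr (M 0 1) = z * (ratr (M 1 0) * z + ratr (M 1 1))
      - ratr (M 0 0) * z :> R by rewrite -eqz; ring.
  by rewrite /y; field.
have : y = z.
  suff [] : Fin y = Fin z by [].
  apply/fixA; rewrite /= !mxE; case: eqVneq => [d0|d0]; last first.
    by rewrite eqy mulfK.
  (* If the denominator vanished at [y], [eqy] would make the numerator vanish too, forcing
     determinant zero. *)
  case/eqP: dM; rewrite d0 mulr0 in eqy.
  transitivity (ratr (M 0 0) * (ratr (M 1 0) * y + ratr (M 1 1))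
     - ratr (M 1 0) * (ratr (M 0 0) * y + ratr (M 0 1)) : R); first by ring.
  by rewrite d0 eqy; ring.
rewrite /y => yz; exists ((M 0 0 - M 1 1) / M 1 0 / 2%:R) => //.
congr Fin; rewrite !fmorph_div rmorphB /= ratr_nat.
have -> : (ratr (M 0 0) - ratr (M 1 1)) / ratr (M 1 0) = z + z.
  by rewrite -{1}yz subrK.
by field.
Qed.

End Cusps.

(** * Translations, rationality and cusps of [Delta] *)

Section DeltaGroup.

(** Here [w] stands for $u$ and [a] for the root of $t-1-u^2$, so the shift is $2t$. The matrix
    product is minus the translation; the two agree only in [PSL2]. *)
Lemma commutator_translation (F : fieldType) (a w : F) (A B : SL2 F) :
    a != 0 -> w != 0 ->
    sl2mx A = a^-1 *: mx22 (a ^+ 2 + w ^+ 2) (w ^+ 2) 1 1 ->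
    sl2mx B = (w * a)^-1 *: mx22 (w ^+ 2) (w ^+ 2) 1 (a ^+ 2 + 1) ->
  \pi_(PSL2 F) (A * B^-1 * A^-1 * B)%g =
  \pi_(PSL2 F) (translation (2%:R * (a ^+ 2 + 1 + w ^+ 2))).
Proof.
move=> a0 w0 AE BE; apply/eqP/eq_pmP; right.
rewrite -[LHS]/(sl2mx A *m invmx B *m invmx A *m B) !invmx22 AE BE.
by apply: eq_mx22; rewrite !(mulmx22E, mxE) /=; field; rewrite a0 w0.
Qed.

Variables (R : realType) (u2 t : rat) (ut : 0 < u2 < t - 1).

Lemma Delta_subgroup : is_subgroup (Delta R ut).
Proof. exact: generated_subgroup. Qed.

Lemma Delta_translation :
  Delta R ut (\pi_(PSL2 R) (translation (ratr (2%:R * t)))).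
Proof.
have [_ DM DV] := Delta_subgroup.
have D1 : Delta R ut (\pi_(PSL2 R) (MkSL2 (det_g1 R ut))).
  by move=> H [_]; apply; left.
have D2 : Delta R ut (\pi_(PSL2 R) (MkSL2 (det_g2 R ut))).
  by move=> H [_]; apply; right.
have /andP[u0 u_lt] := ut.
have u0R : 0 < ratr u2 :> R by rewrite ltr0q.
have s0R : 0 < ratr (-1 + t - u2) :> R by rewrite ltr0q; lra.
pose a : R := Num.sqrt (ratr (-1 + t - u2)); pose w : R := Num.sqrt (ratr u2).
have a2 : a ^+ 2 = ratr t - 1 - ratr u2.
  by rewrite sqr_sqrtr ?ltW // rmorphB rmorphD rmorphN1 /=; ring.
have w2 : w ^+ 2 = ratr u2 by rewrite sqr_sqrtr ?ltW.
have -> : ratr (2%:R * t) = 2%:R * (a ^+ 2 + 1 + w ^+ 2).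
  by rewrite a2 w2 rmorphM /= ratr_nat; ring.
rewrite -(@commutator_translation _ a w (MkSL2 (det_g1 R ut))
  (MkSL2 (det_g2 R ut))) ?gt_eqF ?sqrtr_gt0 //.
- rewrite -!pi_mulg -!pi_invg.
  exact: (DM _ _ (DM _ _ (DM _ _ D1 (DV _ D2)) (DV _ D1)) D2).
- rewrite /= /g1mx; congr (_ *: _).
  by apply: eq_mx22; rewrite !mxE /= ?a2 ?w2 ?rmorphB ?rmorph1 //=; ring.
- rewrite /= /g2mx; congr (_ *: _).
  by apply: eq_mx22; rewrite !mxE /= ?a2 ?w2 ?rmorphB ?rmorph1 //=; ring.
Qed.

Lemma Delta_rational : Delta R ut `<=` @rational_psl2 R.
Proof.
have /andP[u0 u_lt] := ut.
have u0R : 0 < ratr u2 :> R by rewrite ltr0q.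
have s0R : 0 < ratr (-1 + t - u2) :> R by rewrite ltr0q; lra.
(* [generated] is the smallest subgroup, so only the two generators need checking. *)
move=> g; apply; split; first exact: rational_psl2_subgroup.
move=> _ [] ->.
- exists (MkSL2 (det_g1 R ut)) => //.
  exists (Num.sqrt (ratr (-1 + t - u2)))^-1, (mx22 (t - 1) u2 1 1).
  split; first by rewrite invr_eq0 gt_eqF ?sqrtr_gt0.
  by congr (_ *: _); apply: eq_mx22; rewrite !mxE /= ?rmorph1.
- exists (MkSL2 (det_g2 R ut)) => //.
  exists (Num.sqrt (ratr u2) * Num.sqrt (ratr (-1 + t - u2)))^-1,
    (mx22 u2 u2 1 (t - u2)).
  split; first by rewrite invr_eq0 mulf_neq0 ?gt_eqF ?sqrtr_gt0.
  by congr (_ *: _); apply: eq_mx22; rewrite !mxE /= ?rmorph1.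
Qed.

Lemma Delta_cusps_translate (z : R) (k : int) :
  cusps (Delta R ut) (Fin z) ->
  cusps (Delta R ut) (Fin (z + ratr (2%:R * t) * k%:~R)).
Proof.
have DG := Delta_subgroup.
have DT := Delta_translation; have [_ _ DV] := DG.
set T := \pi_(PSL2 R) _ in DT; set s : R := ratr _.
have TE x : psl2_act T (Fin x) = Fin (x + s).
  by rewrite psl2_actE mobius_translation.
have TVE x : psl2_act T^-1%g (Fin x) = Fin (x - s).
  by rewrite -{1}(subrK s x) -TE psl2_actVK.
move=> cz; elim/int_ind: k => [|n IH|n IH]; first by rewrite mulr0 addr0.
  rewrite (_ : z + _ = z + s * n%:~R + s) -?TE; first exact: cusps_act.
  by rewrite intS intrD; ring.
rewrite (_ : z + _ = z + s * (- n%:Z)%:~R - s) -?TVE.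
  by apply: cusps_act => //; apply: DV.
by rewrite intS; ring.
Qed.

End DeltaGroup.

(** * Approximation and integrality in the finite adeles *)

Section Adeles.

(** After subtracting the residue, the component at modulus [i.+2 * n.+2] is divisible by [i.+2];
    the quotients, taken modulo [n.+2], form a compatible family. *)
Lemma zhat_residue (i : nat) (x : Zhat) :
  exists y : Zhat, x = (x i : nat)%:R + i.+2%:R * y.
Proof.
suff [y yE] : exists y : Zhat, x - (x i : nat)%:R = i.+2%:R * y.
  by exists y; rewrite -yE addrC subrK.
have [w [-> wi]] : exists w, x - (x i : nat)%:R = w /\ w i = 0.
  exists (x - (x i : nat)%:R); split=> //.
  by rewrite -[LHS]/(x i - ((x i : nat)%:R : Zhat) i) zhat_natE natr_Zp subrr.
(* Index [n] carries modulus [n.+2], hence the shift by 2. *)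
pose idx n := (i.+2 * n.+2).-2.
have idxE n : (idx n).+2 = (i.+2 * n.+2)%N by rewrite /idx mulSn !addSn.
pose c n := (w (idx n) %/ i.+2)%N.
have cE n : (i.+2 * c n)%N = w (idx n).
  rewrite mulnC divnK //.
  have /(zhat_red w) : (i.+2 %| (idx n).+2)%N by rewrite idxE dvdn_mulr.
  by rewrite wi => /(congr1 val); rewrite /zred Zp_nat /= => /eqP.
have cP m n : (m.+2 %| n.+2)%N ->
    ((c n)%:R = (c m)%:R :> 'I_m.+2).
  move=> dv; have /(zhat_red w) : ((idx m).+2 %| (idx n).+2)%N.
    by rewrite !idxE dvdn_pmul2l.
  move/(congr1 val); rewrite /zred Zp_nat /= -!cE [X in (_ %% X)%N]idxE.
  rewrite -muln_modr => /eqP; rewrite eqn_pmul2l // => /eqP cmn.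
  by apply: val_inj; rewrite !Zp_nat /= -cmn modn_mod.
have yP m n : (m.+2 %| n.+2)%N ->
    (((c n)%:R : 'I_n.+2) = ((c m)%:R : 'I_m.+2) %[mod m.+2])%N.
  by move=> dv; apply/eqmod_zred; rewrite zred_nat // cP.
exists (MkZhat yP); apply: zhatP => n.
rewrite -(@zhat_red n (idx n) w) ?idxE ?dvdn_mull // /zred -cE natrM.
by rewrite -zhat_natE.
Qed.

Lemma zhat_approx (j : int) (x : Zhat) : j != 0 ->
  exists (k : nat) (y : Zhat), x = k%:R + j%:~R * y.
Proof.
move=> j0; have [y {1}->] := zhat_residue (2 * `|j|).-2 x.
have e : ((2 * `|j|).-2.+2 = 2 * `|j|)%N.
  by move: j0; rewrite -absz_gt0; case: `|j|%N => // n _; rewrite mulnS.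
exists (x (2 * `|j|).-2), ((Num.sg j)%:~R * 2%:R * y); congr (_ + _).
rewrite e natrM [2%:R * _]mulrC !mulrA; congr (_ * _ * _).
by rewrite -[_%:R]/(`|j|%N%:~R) abszE normrEsg intrM mulrC.
Qed.

(** With $q = ei$ and $m = ej$, the tensor of $q$ and $x$ is that of $e$ and $ix$; an integer $k$
    congruent to $ix$ modulo $j$ puts $ek$ in the given neighborhood. *)
Lemma rat_dense_finadele : dense (range adele_of_rat).
Proof.
move=> U [a Ua]; rewrite openE => /(_ a Ua) [m m0 mU].
elim/tensorW: a Ua mU => q x _ mU.
have [e [i [j [qE mE]]]] := rat_common q m.
have j0 : j != 0.
  by move: m0; rewrite mE mulf_eq0 negb_or intr_eq0 => /andP[].
have [k [y xE]] := zhat_approx (i%:~R * x) j0.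
exists (adele_of_rat (e * k%:~R)); split; last by exists (e * k%:~R).
apply: mU; exists (tensor m (- y)); first by exists (- y).
rewrite qE mE -!tensorZ -tensorDr xE mulrN addrK.
by rewrite /adele_of_rat -tensorZ mulr1.
Qed.

(* [Q] meets [Zhat] in [Z]. *)
Lemma adele_of_rat_coset (m q r : rat) (z : Zhat) : m != 0 ->
  adele_of_rat q = adele_of_rat r + tensor m z ->
  exists k : int, q = r + m * k%:~R.
Proof.
move=> m0 qrE.
have {qrE} qrE : tensor (q - r) 1 = tensor m z.
  by apply: (addrI (tensor r 1)); rewrite -tensorDl addrC subrK.
pose p := (q - r) / m.
have pE : q - r = m * p by rewrite /p mulrC divfK.
have : (numq m * numq p)%:~R * (1 : Zhat) = (numq m * denq p)%:~R * z.
  apply/(@tensor_eq (q - r) 1 m z _ _ (denq m * denq p)) => //.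
  - by rewrite mulf_neq0 ?denq_neq0.
  - rewrite pE -{1}(divq_num_den m) -{1}(divq_num_den p) !intrM.
    by field; rewrite !denqr_neq0.
  - by rewrite -{1}(divq_num_den m) !intrM; field; rewrite !denqr_neq0.
rewrite !intrM -!mulrA => /zhat_torsion_free; rewrite numq_eq0 m0 mulr1.
move=> /(_ isT) pz; exists (numq p).
suff d1 : denq p = 1.
  have <- : p = (numq p)%:~R by rewrite -{1}(divq_num_den p) d1 divr1.
  by rewrite -pE addrC subrK.
have cop := coprime_num_den p.
have dE : denq p = `|denq p|%N by rewrite absz_denq.
(* The sign of the numerator moves into [z], leaving a divisibility between natural numbers. *)
have nE : (`|numq p|%:R : Zhat) = `|denq p|%:R * ((Num.sg (numq p))%:~R * z).
  rewrite -[_%:R]/(`|numq p|%N%:~R) abszE normrEsg intrM pz dE.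
  by rewrite absz_nat; ring.
move: cop nE dE; case: `|denq p|%N => [|[|n]].
- by move=> _ _ e; have := denq_neq0 p; rewrite e.
- by move=> _ _ ->.
(* For a denominator [n.+2], the component at index [n] shows that it divides the numerator, against
   coprimality. *)
move=> cop /(congr1 (fun x : Zhat => x n)).
rewrite -[X in _ = X]/((n.+2%:R : Zhat) n * ((Num.sg (numq p))%:~R * z) n).
rewrite !zhat_natE Zp_nat [n.+2%:R]Zp_nat.
rewrite [inZp n.+2](_ : _ = 0); last by apply: val_inj; rewrite /= modnn.
rewrite mul0r => /(congr1 val) /= /eqP dv.
have : (n.+2 %| gcdn `|numq p| n.+2)%N by rewrite dvdn_gcd dvdnn andbT.
by rewrite (eqP cop) dvdn1.
Qed.

Lemma scaledZhat_coset_open (m : rat) (a : finadele) : m != 0 ->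
  open [set a + b | b in scaledZhat m].
Proof.
move=> m0; rewrite openE => _ [_ [x _ <-] <-]; exists m => //.
move=> _ [_ [y _ <-] <-]; exists (tensor m (x + y)); first by exists (x + y).
by rewrite tensorDr addrA.
Qed.

End Adeles.

Theorem theorem1 (R : realType) (u2 t : rat) (ut : 0 < u2 < t - 1) :
  pseudomodular (Delta R ut) \/ arithmetic (Delta R ut)
  <->
  dense [set adele_of_rat q | q in [set q : rat |
           finite_cusps (Delta R ut) (ratr q)]].
Proof.
have t0 : 2%:R * t != 0 by have /andP[? ?] := ut; rewrite gt_eqF //; lra.
split=> [H|D].
  (* Once every rational is a cusp, the set in question is the whole image of the rationals. *)
  suff cQ q : finite_cusps (Delta R ut) (ratr q).
    rewrite [X in dense X](_ : _ = range adele_of_rat).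
      exact: rat_dense_finadele.
    by apply/seteqP; split=> _ [q _ <-]; exists q => //; apply: cQ.
  case: H => [[_ cE]|ar].
    by rewrite /finite_cusps /= cE; right; exists q.
  by apply: arithmetic_cusps ar; apply: Delta_subgroup.
have [ar|nar] := pselect (arithmetic (Delta R ut)); [by right | left].
split=> //; apply/seteqP; split; first exact/cusps_rational/Delta_rational.
move=> _ [->|[q _ <-]].
  (* Infinity is a cusp because of the commutator translation. *)
  exists (\pi_(PSL2 R) (translation (ratr (2%:R * t)))).
    exact: Delta_translation.
  by move=> y; apply: translation_fix; rewrite fmorph_eq0.
(* Density is applied to the open coset of [q] modulo $2t\widehat{\mathbb{Z}}$; the cusp [c] found
   there differs from [q] by an integer multiple of $2t$. *)
have [|a [[_ [z _ <-] zE] [c cc cE]]] :=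
  D _ _ (@scaledZhat_coset_open (2%:R * t) (adele_of_rat q) t0).
  by exists (adele_of_rat q), 0; rewrite ?addr0 //; exists 0; rewrite ?tensor0.
have [k ck] := adele_of_rat_coset t0 (etrans cE (esym zE)).
have -> : ratr q = ratr c + ratr (2%:R * t) * (- k)%:~R :> R.
  by rewrite ck rmorphD rmorphM /= ratr_int rmorphN /= mulrN addrK.
exact: Delta_cusps_translate.
Qed.
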